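(* Let $G$ be a finite group and let $(\Omega,\leq)$ be a $G$-admissible graded finite poset of rank $m$. Fix an integer $t$ with $0\leq t<m$. Let $X=X_m$ be the top fiber of $\Omega$ and let $D\subseteq X$ be a $t$-design of index $\lambda$, with $b_D=|D|$. Assume the following. (1) The Schurian association scheme of $G$ on $X$ is commutative, so that $\mathbb{C}^X=U_0\oplus U_1\oplus\cdots\oplus U_m$ is an orthogonal decomposition into pairwise non-isomorphic irreducible $\mathbb{C}[G]$-modules with $U_0=\mathbb{C}\boldsymbol{1}$. (2) At least one of the following holds: (i) for each $i\in\{0,1,\ldots,m\}$, $\operatorname{Im}(W_i^* )=U_0\oplus U_1\oplus\cdots\oplus U_i$; (ii) there exist scalars $\gamma_{i,j}\geq 0$ ($0\le i,j\le m$) such that $W_i^*W_i|_{U_j}=\gamma_{i,j}I$, with $\gamma_{i,j}>0$ for all $0\leq j\leq i$ and $\gamma_{i,j}=0$ for all $i<j\leq m$. (3) For every $i=t+1,t+2,\ldots,m$, $$A_i+\sum_{j=t+1}^{i-1}B_{i,j}\left(1-\lambda^{-1}A_j\right)<1,$$ where $A_i:=\dfrac{\gamma_{i,0}b_D}{|X|\alpha_i}$ and $B_{i,j}:=\dfrac{\lambda\alpha_j\gamma_{i,j}}{\alpha_i\gamma_{j,j}}$ for $t<j\leq i\leq m$. Then $$\operatorname{proj}_{U_1}(\boldsymbol{1}_D)=\operatorname{proj}_{U_2}(\boldsymbol{1}_D)=\cdots=\operatorname{proj}_{U_t}(\boldsymbol{1}_D)=0$$ and $\operatorname{proj}_{U_i}(\boldsymbol{1}_D)\neq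 0$ for every $i\in\{0,t+1,t+2,\ldots,m\}$. More precisely, $\|\operatorname{proj}_{U_0}(\boldsymbol{1}_D)\|^2=b_D^2/|X|$ and $$\|\operatorname{proj}_{U_i}(\boldsymbol{1}_D)\|^2\geq\frac{b_D\alpha_i}{\gamma_{i,i}}\left(1-A_i-\sum_{j=t+1}^{i-1}B_{i,j}\left(1-\frac{A_j}{\lambda}\right)\right)>0$$ for every $i\in\{t+1,t+2,\ldots,m\}$.
   Context: Graded poset: a finite poset $\Omega$ with a rank function $\operatorname{rk}:\Omega\to\mathbb{N}$ such that $x\le y$ implies $\operatorname{rk}(x)\le\operatorname{rk}(y)$, and $\operatorname{rk}(y)=\operatorname{rk}(x)+1$ whenever $y$ covers $x$. Its rank is $m=\max\operatorname{rk}$, its $i$-th fiber is $X_i=\{x:\operatorname{rk}(x)=i\}$ (so $\Omega=X_0\sqcup\cdots\sqcup X_m$), and $X:=X_m$ is the top fiber. $G$-admissible graded poset: a finite graded poset $(\Omega,\le)$ of rank $m$ on which a finite group $G$ acts, such that: (1) for all $0\le i\le m$, the number $\alpha_i:=\#\{z\in X_i: z\le x\}$ does not depend on $x\in X_m$; (2) for all $0\le t<i\le m$ and every $z\in X_i$ there is at least one $y\in X_t$ with $y\le z$; (3) for all $z,x\in\Omega$, $g\in G$: $z\le x$ iff $gz\le gx$; (4) $G$ acts transitively on $X_m$. The Schurian association scheme of $G$ on $X$ is the association scheme whose relations are the orbits of $G$ on $X\times X$; it is commutative iff the permutation module $\mathbb{C}^X$ is multiplicity-free. It is assumed that the number of irreducible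 constituents is $m+1$, where $m$ is the rank of $\Omega$; they are labelled $U_0,\dots,U_m$. $\operatorname{proj}_{U_i}$ is the orthogonal projection onto $U_i$ for the standard Hermitian inner product $\langle f,g\rangle=\sum_{x\in X}f(x)\overline{g(x)}$, and $\|f\|=\sqrt{\langle f,f\rangle}$. $\boldsymbol{1}$ is the all-ones function. Incidence operator: $W_i:\mathbb{C}^X\to\mathbb{C}^{X_i}$, $(W_if)(z)=\sum_{x\in X,\,x\ge z}f(x)$; its adjoint is $(W_i^*h)(x)=\sum_{z\in X_i,\,z\le x}h(z)$. A $t$-design of index $\lambda$ in $X$ is a non-empty subset $D\subseteq X$ such that $\#\{x\in D: x\ge z\}=\lambda$ for every $z\in X_t$. $\boldsymbol{1}_D$ is its characteristic vector. Conditions (i) and (ii) in hypothesis (2) are equivalent in this setting; the $\gamma_{i,j}$ in hypothesis (3) and in the conclusion are the scalars with $W_i^*W_i|_{U_j}=\gamma_{i,j}I$. *)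

(* Defs.v *)
From HB Require Import structures.
From mathcomp Require Import classical_sets reals.
From mathcomp Require Import all_boot all_order all_algebra all_fingroup.
From mathcomp Require Import sesquilinear spectral mxrepresentation.
From mathcomp Require Import complex.

Set Implicit Arguments.
Unset Strict Implicit.
Unset Printing Implicit Defensive.

Import Order.TTheory GRing.Theory Num.Theory.
Local Open Scope ring_scope.

Section GradedPoset.
Context {d : Order.disp_t} {Omega : finPOrderType d}.
Variables (rk : Omega -> nat) (m : nat).

Definition covers (x y : Omega) : Prop :=
  (x < y)%O /\ forall z : Omega, ~ ((x < z)%O /\ (z < y)%O).

Record graded_poset : Prop := GradedPoset {
  graded_homo : forall x y : Omega, (x <= y)%O -> (rk x <= rk y)%N;
  graded_covers : forall x y : Omega, covers x y -> rk y = (rk x).+1;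
  graded_rank : \max_(x : Omega) rk x = m }.

Definition fiber (i : nat) : {set Omega} := [set x | rk x == i].

Definition lower_count (i : nat) (x : Omega) : nat :=
  #|[set z in fiber i | (z <= x)%O]|.

(* The common value of [lower_count i x] over the top fiber; it is only
   meaningful when that count does not depend on [x]. *)
Definition alpha (i : nat) : nat :=
  if [pick x in fiber m] is Some x then lower_count i x else 0%N.

Definition t_design (t : nat) (D : {set Omega}) (lambda : nat) : Prop :=
  [/\ D != finset.set0, D \subset fiber m &
      forall z, z \in fiber t -> #|[set x in D | (z <= x)%O]| = lambda].

(* Actions of [action] are right actions; [to x g] is g^-1 x for the
   corresponding left action. *)
Record admissible {gT : finGroupType} {G : {group gT}} (to : action G Omega) :
  Prop := Admissible {
  adm_graded : graded_poset;
  adm_alpha : forall i, (i <= m)%N ->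
    {in fiber m &, forall x y, lower_count i x = lower_count i y};
  adm_below : forall t i, (t < i <= m)%N ->
    forall z, z \in fiber i -> exists2 y, y \in fiber t & (y <= z)%O;
  adm_order : forall g, g \in G ->
    forall z x : Omega, (z <= x)%O = (to z g <= to x g)%O;
  adm_trans : [transitive G, on fiber m | to] }.

End GradedPoset.

Section Scheme.
Variables (T : finType) (gT : finGroupType) (G : {group gT}).
Variables (to : action G T) (X : {set T}).

Definition orbitals : {set {set T * T}} :=
  [set [set (to p.1 g, to p.2 g) | g in G] | p in setX X X].

(* The intersection numbers satisfy p_(R, S)^Q = p_(S, R)^Q for all orbitals
   R, S, Q; the orbital Q is that of (x, y). *)
Definition commutative_scheme : Prop :=
  forall R S : {set T * T}, R \in orbitals -> S \in orbitals ->
  forall x y : T, x \in X -> y \in X ->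
    #|[set z in X | ((x, z) \in R) && ((z, y) \in S)]| =
    #|[set z in X | ((x, z) \in S) && ((z, y) \in R)]|.

End Scheme.

(* A function f : X -> C on X : {set T} is the row vector indexed by 'I_#|X|
   whose entry at i is f (enum_val i). *)
Section Functions.
Context {C : numClosedFieldType} {T : finType}.

Definition charvec (X D : {set T}) : 'rV[C]_#|X| :=
  \row_i (enum_val i \in D)%:R.

Definition l2norm n (f : 'rV[C]_n) : C := sqrtC (dotmx f f).

Variables (gT : finGroupType) (G : {group gT}) (to : action G T) (X : {set T}).

(* f *m perm_mx_of g is the function x |-> f (to x g^-1). *)
Definition perm_mx_of (g : gT) : 'M[C]_#|X| :=
  \matrix_(i, j) (to (enum_val i) g == enum_val j)%:R.

Lemma perm_mx_of_repr : [acts G, on X | to] -> mx_repr G perm_mx_of.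
Proof.
move=> GX; split=> [|g h Gg Gh]; apply/matrixP => i j; rewrite !mxE.
  by rewrite act1 (inj_eq enum_val_inj).
have Xig : to (enum_val i) g \in X by rewrite (acts_act GX) ?enum_valP.
rewrite (bigD1 (enum_rank_in Xig (to (enum_val i) g))) //= !mxE.
rewrite enum_rankK_in // eqxx mul1r actMin // big1 ?addr0 // => k nk.
rewrite !mxE; case: eqP => [e|_]; last by rewrite mul0r.
by case/eqP: nk; apply: enum_val_inj; rewrite enum_rankK_in.
Qed.

Lemma trans_acts : [transitive G, on X | to] -> [acts G, on X | to].
Proof.
case/imsetP=> x0 _ defX; apply/subsetP => g Gg; rewrite inE Gg inE /=.
apply/subsetP=> x; rewrite inE defX => /imsetP[h Gh ->].
by apply/imsetP; exists (h * g)%g; rewrite ?groupM // actMin.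
Qed.

Definition perm_repr (GX : [transitive G, on X | to]) :
    mx_representation C G #|X| :=
  MxRepresentation (perm_mx_of_repr (trans_acts GX)).

End Functions.

Section Incidence.
Variables (C : numClosedFieldType) (d : Order.disp_t).
Context {Omega : finPOrderType d}.
Variables (rk : Omega -> nat) (m : nat).

(* The incidence operator W_i is [mulmxr (incidence i)], its adjoint W_i^* is
   [mulmxr (incidence i)^T]; see [incidenceE] and [incidence_trE]. *)
Definition incidence (i : nat) : 'M[C]_(#|fiber rk m|, #|fiber rk i|) :=
  \matrix_(x, z) (enum_val z <= enum_val x)%O%:R.

Lemma incidenceE (i : nat) (f : Omega -> C) (z : 'I_#|fiber rk i|) :
  ((\row_x f (enum_val x)) *m incidence i) 0 z =
  \sum_(x in fiber rk m | (enum_val z <= x)%O) f x.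
Proof.
rewrite mxE big_mkcondr [RHS]big_enum_val /=.
by apply: eq_bigr => x _; rewrite !mxE; case: (_ <= _)%O; rewrite ?mulr1 ?mulr0.
Qed.

Lemma incidence_trE (i : nat) (h : Omega -> C) (x : 'I_#|fiber rk m|) :
  ((\row_z h (enum_val z)) *m (incidence i)^T) 0 x =
  \sum_(z in fiber rk i | (z <= enum_val x)%O) h z.
Proof.
rewrite mxE big_mkcondr [RHS]big_enum_val /=.
by apply: eq_bigr => z _; rewrite !mxE; case: (_ <= _)%O; rewrite ?mulr1 ?mulr0.
Qed.

End Incidence.

(* The row space of [U j] is the constituent U_j, for j <= m; the matrices
   [U j] with j > m play no role. *)
Record irr_decomposition (C : numClosedFieldType) (gT : finGroupType)
    (G : {group gT}) (n : nat) (rG : mx_representation C G n)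
    (m : nat) (U : nat -> 'M[C]_n) : Prop := IrrDecomposition {
  irrd_simple : forall i, (i <= m)%N -> mxsimple rG (U i);
  irrd_noniso : forall i j, (i <= m)%N -> (j <= m)%N -> i <> j ->
    ~ mx_iso rG (U i) (U j);
  irrd_orth : forall i j, (i <= m)%N -> (j <= m)%N -> i <> j ->
    forall u v : 'rV[C]_n, (u <= U i)%MS -> (v <= U j)%MS -> dotmx u v = 0;
  irrd_direct : mxdirect (\sum_(i < m.+1) U i);
  irrd_full : (\sum_(i < m.+1) U i :=: 1%:M)%MS }.

(* [A] acts on the row space of [U] as multiplication by [c]. *)
Definition acts_as_scalar (C : fieldType) n (A U : 'M[C]_n) (c : C) : Prop :=
  U *m A = c *: U.

(* The scalar by which [A] acts on the row space of [U]; it is unique when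
   [U != 0], and the value is 0 if [A] does not act on [U] as a scalar. *)
Definition scalar_on (C : fieldType) n (A U : 'M[C]_n) : C :=
  xget 0 (acts_as_scalar A U).

(* Main.v *)
Require Import Defs.
From mathcomp Require Import classical_sets reals.
From mathcomp Require Import all_boot all_order all_algebra all_fingroup.
From mathcomp Require Import sesquilinear spectral mxrepresentation.
From mathcomp Require Import complex.
From mathcomp Require Import ring.
Import GRing.Theory Num.Theory.
Local Open Scope ring_scope.

(** Write [b = |D|], [N = |X|], [f] for the characteristic vector of [D], [q_j]
    for the squared norm of its projection to [U_j], and [gamma_(k,j)] for the
    eigenvalue of [W_k^* W_k] on [U_j]. Everything comes from computing the
    energy [w_k := |W_k f|^2] in two ways.

    Spectrally, [w_k = \sum_j gamma_(k,j) q_j] ([dot_scalar_on], [dot_gram]),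
    and the terms with [k < j] vanish. Combinatorially, the entries of [W_k f]
    are the degrees [d_z], the number of blocks of [D] above [z], for [z] of
    rank [k]. They sum to [b alpha_k] by double counting ([sum_degree]); they
    are natural numbers, and when [t <= k] they are at most [lambda], since
    each [z] of rank [k] lies above some [y] of rank [t] and [d_z <= d_y]
    ([degree_le]). From [d_z <= d_z^2 <= lambda d_z] one gets
    [b alpha_k <= w_k <= lambda b alpha_k] ([dot_incidence_bounds]).

    For [k = t] all degrees equal [lambda], so [W_t^* W_t f] is constant and
    lies in [U_0] ([design_gram]); as [gamma_(t,j) > 0] for [1 <= j <= t], the
    projections of [f] to those [U_j] are zero. For [t < k] the energy is thus
    [w_k = gamma_(k,0) q_0 + \sum_(t < j < k) gamma_(k,j) q_j + gamma_(k,k) q_k]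
    with [q_0 = b^2 / N] ([dot_proj_const]). Dropping the middle sum and using
    the upper bound on [w_j] bounds each [q_j] from above; inserting these
    bounds and the lower bound on [w_k] bounds [q_k] from below, and the outcome
    is the stated expression ([triangular_lower_bound]).

    If the spectrum is given only through the images of the [W_k^*], it is
    recovered from Schur's lemma ([irr_scalar]): [W_k^* W_k] commutes with [G]
    ([gram_comm]) because the action preserves the rank ([rank_act]), and the
    [U_j] are simple and pairwise non-isomorphic. The sign of the eigenvalue is
    then read off from the position of [U_j] relative to the image of [W_k^*]
    ([gram_spectrum]). *)

Set Implicit Arguments.
Unset Strict Implicit.
Unset Printing Implicit Defensive.

Import Order.TTheory.
Local Open Scope sesquilinear_scope.

Local Notation "''[' u , v ]" := (dotmx u v) : ring_scope.
Local Notation "''[' u ]" := '[u, u] : ring_scope.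
Local Notation "B ^!" :=
  (orthomx Num.conj (mx_of_hermitian (hermitian1mx _)) B) : matrix_set_scope.

(** * Ranks, orders and degrees in an admissible poset *)

Section AdmissiblePoset.
Context {d : Order.disp_t} {Omega : finPOrderType d}.
Context {rk : Omega -> nat} {m : nat}.

(** A minimal element above [x] and below [y] covers [x]; it is found by
    minimizing the size of the principal down-set. *)
Lemma rank_lt (gp : graded_poset rk m) (x y : Omega) :
  (x < y)%O -> (rk x < rk y)%N.
Proof.
move=> xy; pose P := [pred z : Omega | (x < z)%O && (z <= y)%O].
have Py : P y by rewrite /P /= xy lexx.
case: (arg_minnP (fun z => #|[set w : Omega | (w <= z)%O]|) Py) => z.
move=> /andP[xz zy] zmin.
have cov : covers x z.
  split=> // w [xw wz].
  have /zmin : P w by rewrite /P /= xw (le_trans (ltW wz)).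
  rewrite leqNgt => /negP[]; apply: proper_card; apply/properP; split.
    by apply/subsetP=> v; rewrite !inE => /le_trans -> //; apply: ltW.
  by exists z; rewrite !inE ?lexx // lt_geF.
by rewrite -(graded_covers gp cov) (graded_homo gp zy).
Qed.

Context {gT : finGroupType} {G : {group gT}} {to : action G Omega}.
Hypothesis adm : admissible rk m to.

Lemma rank_le_top x : (rk x <= m)%N.
Proof. by rewrite -(graded_rank (adm_graded adm)) leq_bigmax. Qed.

Lemma act_lt g : g \in G ->
  forall x y, (to x g < to y g)%O = (x < y)%O.
Proof.
move=> Gg x y; rewrite !lt_neqAle -(adm_order adm Gg).
by rewrite (inj_eq (act_inj to g)).
Qed.

Lemma act_covers g x y : g \in G -> covers x y -> covers (to x g) (to y g).
Proof.
move=> Gg [xy nxy]; split=> [|z]; first by rewrite act_lt.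
by rewrite -(actKVin to Gg z) !act_lt //; apply: nxy.
Qed.

Lemma below_fiber i t z : (t <= i <= m)%N -> z \in fiber rk i ->
  exists2 y, y \in fiber rk t & (y <= z)%O.
Proof.
move=> /andP[]; rewrite leq_eqVlt => /predU1P[->|ti] im zi; first by exists z.
by apply: (adm_below adm _ zi); rewrite ti im.
Qed.

(** The action is only assumed to preserve the order, but the order determines
    the rank: since every element of positive rank has an element of rank [0]
    below it, the elements of rank [0] are the minimal ones, and every element
    of positive rank covers one whose rank is one less. *)
Lemma rank_act g : g \in G -> forall z, rk (to z g) = rk z.
Proof.
move=> Gg z; have gp := adm_graded adm.
have [k] := ubnP (rk z); elim: k z => // k IHk z; rewrite ltnS => rz.
have [r0|r_gt0] := posnP (rk z).
  apply/eqP; rewrite r0 -leqn0 leqNgt; apply/negP=> r'_gt0.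
  have [||y] := below_fiber (t := 0) (i := rk (to z g)) (z := to z g).
  - exact: rank_le_top.
  - by rewrite inE.
  rewrite inE => /eqP ry yz.
  have : (y < to z g)%O.
    by rewrite lt_neqAle yz andbT; apply: contraTneq r'_gt0 => <-; rewrite ry.
  by rewrite -(actKVin to Gg y) act_lt // => /(rank_lt gp); rewrite r0.
have [||y] := below_fiber (t := (rk z).-1) (i := rk z) (z := z).
- by rewrite leq_pred rank_le_top.
- by rewrite inE.
rewrite inE => /eqP ry yz.
have rzS : rk z = (rk y).+1 by rewrite ry prednK.
(* An element strictly between would have a rank strictly between. *)
have cov : covers y z.
  split=> [|w [/(rank_lt gp) yw /(rank_lt gp)]].
    by rewrite lt_neqAle yz andbT; apply/eqP=> e; move: rzS; rewrite e => /n_Sn.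
  by rewrite rzS ltnS leqNgt yw.
rewrite (graded_covers gp (act_covers Gg cov)) rzS IHk //.
by rewrite -ltnS -rzS.
Qed.

Lemma alphaE i x : (i <= m)%N -> x \in fiber rk m ->
  lower_count rk i x = alpha rk m i.
Proof.
move=> im xX; rewrite /alpha; case: pickP => [y yX|/(_ x)]; last by rewrite xX.
exact: (adm_alpha adm im).
Qed.

Lemma alpha_gt0 i x : (i <= m)%N -> x \in fiber rk m -> (0 < alpha rk m i)%N.
Proof.
move=> im xX; rewrite -(alphaE im xX); apply/card_gt0P.
have [|y yi yx] := below_fiber (t := i) _ xX; first by rewrite im leqnn.
by exists y; rewrite in_set yi.
Qed.

Definition degree (D : {set Omega}) z := #|[set x in D | (z <= x)%O]|.

Lemma sum_degree (D : {set Omega}) i : (i <= m)%N -> D \subset fiber rk m ->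
  (\sum_(z in fiber rk i) degree D z = #|D| * alpha rk m i)%N.
Proof.
move=> im /subsetP DX; rewrite -sum_nat_const.
under eq_bigr => z _ do rewrite /degree -sum1dep_card.
rewrite (exchange_big_dep (mem D)) /=; last by move=> z x _ /andP[].
apply: eq_bigr => x xD.
rewrite -(alphaE im (DX _ xD)) /lower_count -sum1dep_card.
by apply: eq_bigl => z; rewrite xD.
Qed.

Context {t lambda : nat} {D : {set Omega}}.
Hypotheses (ltm : (t < m)%N) (desD : t_design rk m t D lambda).

(** A block above [z] is also above any [y <= z] of rank [t], and there is
    such a [y]. *)
Lemma degree_le i z : (t <= i <= m)%N -> z \in fiber rk i ->
  (degree D z <= lambda)%N.
Proof.
move=> tim zi; have [y yt yz] := below_fiber tim zi.
case: desD => _ _ /(_ _ yt) <-; apply: subset_leq_card; apply/subsetP=> x.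
by rewrite !inE => /andP[-> /(le_trans yz)].
Qed.

Lemma design_index_gt0 : (0 < lambda)%N.
Proof.
case: desD => /set0Pn[x xD] /subsetP DX degD.
have [|y yt yx] := below_fiber (t := t) _ (DX _ xD); first by rewrite ltnW /=.
by rewrite -(degD _ yt); apply/card_gt0P; exists x; rewrite inE xD.
Qed.

End AdmissiblePoset.

(** * Orthogonal decompositions of a space of row vectors *)

Section OrthogonalDecomposition.
Context {C : numClosedFieldType} {n : nat}.
Implicit Types u v : 'rV[C]_n.

Lemma l2norm_sqr u : l2norm u ^+ 2 = '[u].
Proof. exact: sqrtCK. Qed.

Lemma orthomx_dotP p q (A : 'M[C]_(p, n)) (B : 'M[C]_(q, n)) :
  reflect (forall u v, (u <= A)%MS -> (v <= B)%MS -> '[u, v] = 0) (A <= B^!)%MS.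
Proof.
apply: (iffP idP) => [/orthomx1P AB u v /submxP[x ->] /submxP[y ->]|dotAB].
  rewrite dotmxE trmx_mul map_mxM -!mulmxA (mulmxA A) AB.
  by rewrite mul0mx mulmx0 mxE.
apply/orthomx1P/matrixP=> i j; rewrite [RHS]mxE.
have := dotAB _ _ (row_sub i A) (row_sub j B); rewrite dotmxE => <-.
by rewrite !mxE; apply: eq_bigr => k _; rewrite !mxE.
Qed.

Lemma dotmx_proj p (V : 'M[C]_(p, n)) u v :
  (v <= V)%MS -> '[v, u *m proj_ortho V] = '[v, u].
Proof.
move=> vV; apply/eqP; rewrite eq_sym -subr_eq0 -linearBr /=.
have upV := proj_ortho_compl_sub V u; rewrite orthomx_sym in upV.
by apply/eqP/(orthomx_dotP _ _ upV).
Qed.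

Context {m : nat} {U : nat -> 'M[C]_n}.
Hypothesis orthU : forall i j, (i <= m)%N -> (j <= m)%N -> i <> j ->
  forall u v, (u <= U i)%MS -> (v <= U j)%MS -> '[u, v] = 0.
Hypothesis fullU : (\sum_(i < m.+1) U i :=: 1%:M)%MS.

(** The inclusion from right to left is orthogonality; equality follows by
    counting dimensions. This description of the orthogonal complement is what
    makes it a submodule when the summands are. *)
Lemma ortho_summand (i : 'I_m.+1) :
  ((U i)^! :=: \sum_(j < m.+1 | j != i) U j)%MS.
Proof.
have sub : (\sum_(j < m.+1 | j != i) U j <= (U i)^!)%MS.
  apply/sumsmx_subP=> j ji; apply/orthomx_dotP; apply: orthU.
  - exact: ltn_ord j.
  - exact: ltn_ord i.
  - by move/val_inj/eqP; apply/negP.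
apply: eqmx_sym; apply/eqmxP; rewrite -mxrank_leqif_eq //.
apply/eqP/anti_leq/andP; split; first exact: mxrankS.
have rkU : \rank (\sum_(j < m.+1) U j)%MS = n by rewrite fullU mxrank1.
rewrite rank_ortho leq_subLR -[X in (X <= _)%N]rkU (bigD1 i) //=.
exact: mxrank_adds_leqif.
Qed.

Lemma sum_proj u : u = \sum_(i < m.+1) u *m proj_ortho (U i).
Proof.
have /sub_sumsmxP[w {1 2}->] : (u <= \sum_(i < m.+1) U i)%MS.
  by rewrite fullU submx1.
apply: eq_bigr => i _; rewrite mulmx_suml (bigD1 i) //= big1 ?addr0.
  by rewrite proj_ortho_id ?submxMl.
move=> j ji; rewrite proj_ortho_0 // ortho_summand.
by rewrite (sumsmx_sup j) // submxMl.
Qed.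

Lemma dot_scalar_on (M : 'M[C]_n) (g : nat -> C) u :
  (forall i, (i <= m)%N -> acts_as_scalar M (U i) (g i)) ->
  '[u *m M, u] = \sum_(i < m.+1) g i * '[u *m proj_ortho (U i)].
Proof.
move=> Mg; rewrite {1}(sum_proj u) mulmx_suml linear_sumlz /=.
apply: eq_bigr => i _; have /submxP[w pE] := proj_ortho_sub (U i) u.
rewrite dotmx_proj ?proj_ortho_sub // {1}pE -mulmxA Mg ?leq_ord //.
by rewrite -scalemxAr -pE linearZl_LR.
Qed.

Lemma proj_scalar_on (M : 'M[C]_n) (g : nat -> C) u (k : nat) :
  (forall i, (i <= m)%N -> acts_as_scalar M (U i) (g i)) -> (k <= m)%N ->
  u *m M *m proj_ortho (U k) = g k *: (u *m proj_ortho (U k)).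
Proof.
move=> Mg; rewrite -ltnS => km; rewrite -[k]/(val (Ordinal km)).
move: (Ordinal km) => i {k km}; rewrite {1}(sum_proj u) !mulmx_suml.
have pM (j : 'I_m.+1) :
    u *m proj_ortho (U j) *m M = g j *: (u *m proj_ortho (U j)).
  have /submxP[w ->] := proj_ortho_sub (U j) u.
  by rewrite -mulmxA Mg ?leq_ord // scalemxAr.
rewrite (bigD1 i) //= pM -scalemxAl proj_ortho_id ?proj_ortho_sub //.
rewrite big1 ?addr0 // => j ji; rewrite pM -scalemxAl proj_ortho_0 ?scaler0 //.
by rewrite (ortho_summand i) (sumsmx_sup j) // proj_ortho_sub.
Qed.

End OrthogonalDecomposition.

(** * Operators commuting with a multiplicity-free representation *)

Section Schur.
Context {C : numClosedFieldType} {n m : nat}.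
Context {gT : finGroupType} {G : {group gT}} {rG : mx_representation C G n}.
Context {U : nat -> 'M[C]_n} (decU : irr_decomposition rG m U).

Lemma sum_mxmodule (P : pred 'I_m.+1) :
  mxmodule rG (\sum_(i < m.+1 | P i) U i)%MS.
Proof.
apply: sumsmx_module => i _.
by case: (irrd_simple decU (i := i) (ltn_ord i)).
Qed.

(** For [i != j] the map [M] followed by the projection to [U i] is a
    homomorphism from [U j] to [U i], hence zero by Schur's lemma. *)
Lemma irr_stable (M : 'M[C]_n) (j : nat) : (j <= m)%N ->
  (forall g, g \in G -> rG g *m M = M *m rG g) -> (U j *m M <= U j)%MS.
Proof.
move=> jm cM; have [orthU fullU] := (irrd_orth decU, irrd_full decU).
pose P (i : 'I_m.+1) := proj_ortho (U i).
have homP i : (1%:M <= dom_hom_mx rG (P i))%MS.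
  rewrite (submx_trans (sub_adds_genmx_ortho (U i) 1%:M)) // proj_mx_hom //.
  - exact: cap_genmx_ortho.
  - rewrite (eqmx_module _ (genmxE _)).
    by case: (irrd_simple decU (i := i) (ltn_ord i)).
  - by rewrite (eqmx_module _ (ortho_summand orthU fullU i)) sum_mxmodule.
have -> : U j *m M = \sum_(i < m.+1) U j *m M *m P i.
  apply/row_matrixP=> r; rewrite linear_sum /= [LHS](sum_proj orthU fullU).
  by apply: eq_bigr => i _; rewrite [RHS]row_mul.
apply: summx_sub => i _; have [<-|ij] := eqVneq (i : nat) j.
  exact: proj_ortho_sub.
suff -> : U j *m M *m P i = 0 by exact: sub0mx.
apply/eqP; apply/contraT; rewrite -mulmxA => nz.
case: (irrd_noniso decU jm (ltn_ord i) (elimN eqP _)); first by rewrite eq_sym.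
have simU := irrd_simple decU.
apply: mx_Schur_iso nz; [exact: simU jm | exact: simU (leq_ord i) | |].
  apply/hom_mxP=> g Gg; have /hom_mxP/(_ g Gg) := homP i.
  rewrite !mul1mx -!mulmxA => Pg; congr (_ *m _).
  by rewrite [LHS]mulmxA cM // -[LHS]mulmxA Pg.
by rewrite mulmxA proj_ortho_sub.
Qed.

(** Schur's lemma over an algebraically closed field: since [M] preserves
    [U j], it has an eigenvector there, with eigenvalue [c] say; this vector
    lies in the kernel of the homomorphism [M - c], which is therefore not
    injective on [U j], hence zero there. *)
Lemma irr_scalar (M : 'M[C]_n) (j : nat) : (j <= m)%N ->
  (forall g, g \in G -> rG g *m M = M *m rG g) ->
  exists c, acts_as_scalar M (U j) c.
Proof.
move=> jm cM; have simU := irrd_simple decU jm.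
have nzU : U j != 0 by case: simU.
(* The matrix of the restriction of [M] to [U j] in the basis [B]. *)
pose B := row_base (U j).
have [|c] := eigenvalue_closed (B *m M *m pinvmx B).
  by rewrite lt0n mxrank_eq0.
case/eigenvalueP=> v vc nzv; exists c; apply/eqP; apply: contraNT nzv => nzUc.
have homMc : (U j <= dom_hom_mx rG (M - c%:M))%MS.
  apply/hom_mxP=> g Gg; rewrite -!mulmxA; congr (_ *m _).
  by rewrite mulmxBl mulmxBr cM // scalar_mxC.
have := mx_Schur_inj simU homMc; rewrite mulmxBr mul_mx_scalar subr_eq0.
move=> /(_ nzUc) cap0.
have : (v *m B <= U j :&: kermx (M - c%:M))%MS.
  rewrite sub_capmx (submx_trans (submxMl _ _)) ?eq_row_base //=.
  apply/sub_kermxP; rewrite mulmxBr mul_mx_scalar; apply/eqP.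
  rewrite subr_eq0 scalemxAl -vc -[X in _ == X]mulmxA mulmxKpV ?mulmxA //.
  by rewrite /B eq_row_base (eqmxMr _ (eq_row_base _)) irr_stable.
rewrite cap0 submx0 => /eqP vB0; apply/eqP.
by apply: (row_free_inj (row_base_free (U j))); rewrite vB0 mul0mx.
Qed.

End Schur.

(** * Eigenvalues of Gram operators *)

Section GramSpectrum.
Context {C : numClosedFieldType} {n p : nat}.
Variables (A : 'M[C]_(n, p)).
Hypothesis realA : A ^ Num.conj = A.

Lemma dot_gram (u : 'rV[C]_n) : '[u *m (A *m A^T), u] = '[u *m A].
Proof.
by rewrite !dotmxE trmx_mul map_mxM -(map_trmx _ A) realA !mulmxA.
Qed.

Lemma scalar_on_eq (M V : 'M[C]_n) c : V != 0 ->
  acts_as_scalar M V c -> scalar_on M V = c.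
Proof.
move=> nzV Mc; rewrite /scalar_on; case: xgetP => [c' _ Mc'|/(_ c)//].
apply/eqP; rewrite -subr_eq0; apply: contraNT nzV => nzc.
have : (c' - c) *: V == 0 by rewrite scalerBl -Mc -Mc' subrr.
by rewrite scaler_eq0 (negPf nzc).
Qed.

(** On a unit eigenvector [v] the eigenvalue is [|v A|^2], which vanishes
    exactly when [v] is orthogonal to the rows of [A^T]. *)
Lemma gram_spectrum (V : 'M[C]_n) c : V != 0 -> acts_as_scalar (A *m A^T) V c ->
  [/\ 0 <= c, (V <= A^T)%MS -> 0 < c & (V <= (A^T)^!)%MS -> c = 0].
Proof.
move=> /rowV0Pn[v /submxP[w vE] nzv] Ac.
have v_gt0 : 0 < '[v] by rewrite dnorm_gt0.
have vA : '[v *m A] = c * '[v].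
  by rewrite -dot_gram vE -!mulmxA Ac -scalemxAr linearZl_LR.
have cE : c = '[v *m A] / '[v] by rewrite vA mulfK ?gt_eqF.
have vV : (v <= V)%MS by rewrite vE submxMl.
have orthv : (v <= (A^T)^!)%MS = (v *m A == 0).
  by rewrite orthomx1E trmxK realA.
split=> [|VA|VA].
- by rewrite cE divr_ge0 ?dnorm_ge0.
- rewrite cE divr_gt0 // dnorm_gt0 -orthv; apply: contraTN v_gt0 => oA.
  rewrite (orthomx_dotP _ _ oA v v) ?submx_refl ?ltxx //.
  exact: submx_trans VA.
- have /eqP vA0 : v *m A == 0 by rewrite -orthv (submx_trans vV).
  by rewrite cE vA0 linear0l mul0r.
Qed.

End GramSpectrum.

(** * Incidence operators *)

Section IncidenceOperator.
Context {C : numClosedFieldType}.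
Context {d : Order.disp_t} {Omega : finPOrderType d}.
Context {rk : Omega -> nat} {m : nat}.
Context {gT : finGroupType} {G : {group gT}} {to : action G Omega}.
Hypothesis adm : admissible rk m to.

Local Notation W := (incidence C rk m).

Lemma incidence_real i : W i ^ Num.conj = W i.
Proof. by apply/matrixP=> x z; rewrite !mxE conjC_nat. Qed.

Lemma gramE i x y : (W i *m (W i)^T) x y =
  #|[set z in fiber rk i | (z <= enum_val x)%O && (z <= enum_val y)%O]|%:R.
Proof.
rewrite mxE -sum1dep_card natr_sum big_mkcondr [RHS]big_enum_val /=.
by apply: eq_bigr => z _; rewrite !mxE -natrM mulnb; case: (_ && _).
Qed.

(** Translating by [g^-1] moves the common lower bounds of [x g] and [y] to
    those of [x] and [y g^-1], within the same fiber. *)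
Lemma card_below_act i g x y : g \in G ->
  #|[set z in fiber rk i | (z <= to x g)%O && (z <= y)%O]| =
  #|[set z in fiber rk i | (z <= x)%O && (z <= to y g^-1%g)%O]|.
Proof.
move=> Gg; rewrite -[RHS](card_imset _ (act_inj to g)); congr #|pred_of_set _|.
apply/setP=> z; rewrite -(actKVin to Gg z); move: (to z _) => w.
rewrite (mem_imset _ _ (act_inj to g)) !inE (rank_act adm) //.
by rewrite -{1}(actKVin to Gg y) -!(adm_order adm Gg).
Qed.

(** The entry of [W_i W_i^T] at [(x, y)] counts common lower bounds, so it is
    constant on the orbits of pairs. *)
Lemma gram_comm i g : g \in G ->
  let rG := perm_repr (adm_trans adm) : mx_representation C G _ in
  rG g *m (W i *m (W i)^T) = W i *m (W i)^T *m rG g.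
Proof.
move=> Gg rG; have GX := trans_acts (adm_trans adm).
apply/matrixP=> x y.
have Xx : to (enum_val x) g \in fiber rk m by rewrite (acts_act GX) ?enum_valP.
have Xy : to (enum_val y) g^-1%g \in fiber rk m.
  by rewrite (acts_act GX) ?groupV ?enum_valP.
rewrite mxE (bigD1 (enum_rank_in Xx (to (enum_val x) g))) //= big1; last first.
  move=> k nk; rewrite [perm_mx_of _ _ _ _ _]mxE.
  case: eqP => [e|]; last by rewrite mul0r.
  by case/eqP: nk; apply: enum_val_inj; rewrite enum_rankK_in.
rewrite [in RHS]mxE (bigD1 (enum_rank_in Xy (to (enum_val y) g^-1%g))) //=.
rewrite [in RHS]big1; last first.
  move=> k nk; rewrite [perm_mx_of _ _ _ _ _]mxE.
  case: eqP => [e|]; last by rewrite mulr0.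
  by case/eqP: nk; apply: enum_val_inj; rewrite enum_rankK_in // -e actKin.
rewrite !addr0 ![perm_mx_of _ _ _ _ _]mxE !gramE !enum_rankK_in // actKVin //.
by rewrite !eqxx mul1r mulr1 card_below_act.
Qed.

Section Design.
Variable D : {set Omega}.
Hypothesis DX : D \subset fiber rk m.
Local Notation f := (charvec (fiber rk m) D : 'rV[C]_#|fiber rk m|).

Lemma charvec_incidence i :
  f *m W i = \row_z (degree D (enum_val z))%:R.
Proof.
apply/rowP=> z; rewrite [RHS]mxE.
have -> : f = \row_x (enum_val x \in D)%:R by apply/rowP=> x; rewrite !mxE.
rewrite (incidenceE m (fun x => (x \in D)%:R)) /degree -sum1dep_card natr_sum.
rewrite big_mkcondl [RHS]big_mkcondl /=; apply: eq_bigr => x _.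
by have [/(subsetP DX)->|_] := boolP (x \in D); rewrite ?if_same.
Qed.

Lemma dot_row_nat n (e : 'I_n -> nat) :
  '[\row_z (e z)%:R] = (\sum_z e z ^ 2)%:R :> C.
Proof.
rewrite dotmxE mxE natr_sum; apply: eq_bigr => z _.
by rewrite !mxE conjC_nat -natrM mulnn.
Qed.

Lemma dot_incidence i :
  '[f *m W i] = (\sum_(z in fiber rk i) degree D z ^ 2)%:R.
Proof. by rewrite charvec_incidence dot_row_nat [in RHS]big_enum_val. Qed.

Lemma dot_1_charvec : '[const_mx 1, f] = #|D|%:R.
Proof.
rewrite dotmxE mxE.
under eq_bigr => x _ do rewrite !mxE mul1r conjC_nat.
rewrite -[X in _ = X%:R]sum1_card natr_sum [RHS]big_mkcond /=.
rewrite -(big_enum_val (fun x => (x \in D)%:R)) big_mkcond /=.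
apply: eq_bigr => x _.
by have [/(subsetP DX)->|_] := boolP (x \in D); rewrite ?if_same.
Qed.

Lemma dot_1 n : '[const_mx 1 : 'rV[C]_n] = n%:R.
Proof.
rewrite dotmxE mxE; under eq_bigr => x _ do rewrite !mxE mul1r conjC1.
by rewrite sumr_const card_ord.
Qed.

(** The projection to the constants is the constant function with value the
    mean [c = #|D| / N] of [f], where [N] is the number of points, and its
    squared norm is [|c|^2 N]. *)
Lemma dot_proj_const p (V : 'M[C]_(p, #|fiber rk m|)) :
  (V :=: (const_mx 1 : 'rV[C]_#|fiber rk m|))%MS ->
  '[f *m proj_ortho V] = #|D|%:R ^+ 2 / #|fiber rk m|%:R.
Proof.
move=> V1; have := dotmx_proj f (_ : (const_mx 1 <= V)%MS).
rewrite V1 submx_refl dot_1_charvec => /(_ isT).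
have /sub_rVP[c ->] :
    (f *m proj_ortho V <= (const_mx 1 : 'rV[C]_#|fiber rk m|))%MS.
  by rewrite -V1 proj_ortho_sub.
rewrite linearZr_LR /= dot_1 => cN.
have [N0|nzN] := eqVneq (#|fiber rk m|%:R : C) 0.
  by rewrite dnormZ /= dot_1 N0 mulr0 invr0 mulr0.
have {cN} cE : c^* = #|D|%:R / #|fiber rk m|%:R by rewrite -cN mulfK.
rewrite dnormZ /= dot_1 -norm_conjC cE ger0_norm ?divr_ge0 ?ler0n //.
by rewrite expr_div_n -mulrA; congr (_ * _); rewrite expr2 invfM mulfVK.
Qed.

Section Index.
Context {t lambda : nat}.
Hypotheses (ltm : (t < m)%N) (desD : t_design rk m t D lambda).

Lemma design_gram :
  f *m (W t *m (W t)^T) = (lambda * alpha rk m t)%:R *: const_mx 1.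
Proof.
have [_ _ degD] := desD; rewrite mulmxA charvec_incidence.
have -> : \row_z (degree D (enum_val z))%:R =
    \row_(z < #|fiber rk t|) ((fun=> lambda%:R : C) (enum_val z)).
  by apply/rowP=> z; rewrite !mxE [degree _ _]degD ?enum_valP.
apply/rowP=> x; rewrite (incidence_trE t (fun=> lambda%:R)).
rewrite -(alphaE adm (ltnW ltm) (enum_valP x)) !mxE mulr1 sumr_const.
by rewrite natrM mulr_natr /lower_count -sum1dep_card sum1_card.
Qed.

(** Both bounds compare [d] with [d^2] entrywise, for a natural number
    [d <= lambda]. *)
Lemma dot_incidence_bounds k : (t <= k <= m)%N ->
  #|D|%:R * (alpha rk m k)%:R <= '[f *m W k]
    <= lambda%:R * #|D|%:R * (alpha rk m k)%:R.
Proof.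
move=> /[dup] tkm /andP[tk km].
rewrite dot_incidence -!natrM !ler_nat -mulnA -!(sum_degree adm km DX).
rewrite leq_sum /=; last first.
  by move=> z _; rewrite -mulnn; case: degree => // e; exact: leq_pmulr.
rewrite big_distrr /=; apply: leq_sum => z zk; rewrite -mulnn leq_mul2r.
by rewrite (degree_le adm desD tkm zk) orbT.
Qed.

End Index.
End Design.
End IncidenceOperator.

Section Spectrum.
Context {C : numClosedFieldType}.
Context {d : Order.disp_t} {Omega : finPOrderType d}.
Context {rk : Omega -> nat} {m : nat}.
Context {gT : finGroupType} {G : {group gT}} {to : action G Omega}.
Context {adm : admissible rk m to} {U : nat -> 'M[C]_#|fiber rk m|}.
Hypothesis decU : irr_decomposition (perm_repr (adm_trans adm)) m U.

Local Notation W := (incidence C rk m).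
Local Notation gamma k j := (scalar_on (W k *m (W k)^T) (U j)).

(** Starting from the images, Schur's lemma provides an eigenvalue, whose sign
    is known because [U j] lies in the row space of [W_k^T] if [j <= k] and is
    orthogonal to it otherwise. Starting from given eigenvalues, [scalar_on]
    returns them because [U j] is nonzero. *)
Lemma incidence_spectrum :
  (forall k, (k <= m)%N -> ((W k)^T :=: \sum_(j < k.+1) U j)%MS)
  \/ (exists g : nat -> nat -> C,
        forall k j, (k <= m)%N -> (j <= m)%N ->
          [/\ 0 <= g k j, acts_as_scalar (W k *m (W k)^T) (U j) (g k j),
              (j <= k)%N -> 0 < g k j & (k < j)%N -> g k j = 0]) ->
  forall k j, (k <= m)%N -> (j <= m)%N ->
    [/\ 0 <= gamma k j, acts_as_scalar (W k *m (W k)^T) (U j) (gamma k j),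
        (j <= k)%N -> 0 < gamma k j & (k < j)%N -> gamma k j = 0].
Proof.
move=> H k j km jm; have nzU : U j != 0 by case: (irrd_simple decU jm).
case: H => [imW|[g /(_ k j km jm)[g_ge0 gE g_gt0 g_eq0]]]; last first.
  by rewrite (scalar_on_eq nzU gE).
have [c cE] := irr_scalar decU jm (gram_comm adm k).
rewrite (scalar_on_eq nzU cE).
have [c_ge0 c_gt0 c_eq0] := gram_spectrum (incidence_real k) nzU cE.
split=> // [jk|kj]; [apply: c_gt0 | apply: c_eq0].
  by rewrite imW // (sumsmx_sup (Ordinal (jk : j < k.+1)%N)).
rewrite orthomx_sym imW //; apply/sumsmx_subP => i _; apply/orthomx_dotP.
have ik : (i <= k)%N := leq_ord i.
apply: (irrd_orth decU) => //; first exact: leq_trans km.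
by move=> ij; rewrite -ij ltnNge ik in kj.
Qed.

End Spectrum.

(** * Lower bounds from a triangular system *)

Section TriangularBound.

Lemma sum_outside_gaps (V : nmodType) (F : nat -> V) (t k m : nat) :
  (t < k <= m)%N -> (forall j, (1 <= j <= t)%N -> F j = 0) ->
  (forall j, (k < j <= m)%N -> F j = 0) ->
  \sum_(j < m.+1) F j = F 0%N + \sum_(t.+1 <= j < k) F j + F k.
Proof.
move=> /andP[tk km] low high; rewrite -(big_mkord xpredT F) big_ltn //.
rewrite (big_cat_nat (n := t.+1)) //=; last first.
  by rewrite ltnS (leq_trans (ltnW tk)).
rewrite [X in _ + (X + _)]big_nat [X in _ + (X + _)]big1 ?add0r //.
rewrite (big_cat_nat (n := k)) /=; [|by []|exact: leqW].
rewrite [X in _ + (_ + X)]big_ltn ?ltnS //.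
rewrite [X in _ + (_ + (_ + X))]big_nat [X in _ + (_ + (_ + X))]big1 //.
by rewrite addr0 addrA.
Qed.

Context {F : numFieldType} {t m : nat}.
Context {gamma : nat -> nat -> F} {a q w : nat -> F} {b N l : F}.
Hypotheses (N_neq0 : N != 0) (l_neq0 : l != 0).
Hypothesis a_neq0 : forall k, (k <= m)%N -> a k != 0.
Hypothesis gamma_ge0 : forall k j, (k <= m)%N -> (j <= m)%N -> 0 <= gamma k j.
Hypothesis gamma_gt0 : forall k, (k <= m)%N -> 0 < gamma k k.
Hypothesis q_ge0 : forall k, 0 <= q k.
Hypothesis q0E : q 0%N = b ^+ 2 / N.
Hypothesis w_expand : forall k, (t < k <= m)%N ->
  w k = gamma k 0%N * q 0%N + \sum_(t.+1 <= j < k) gamma k j * q j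
        + gamma k k * q k.
Hypothesis w_bounds : forall k, (t < k <= m)%N -> b * a k <= w k <= l * b * a k.

Let A k := gamma k 0%N * b / (N * a k).
Let B k j := l * a j * gamma k j / (a k * gamma j j).

(** The system [w_k = \sum_j gamma_(k,j) q_j] is triangular in the unknowns
    [q_k] with [t < k], with nonnegative coefficients: the upper bounds on [w_j]
    bound [q_j] from above, and these bounds enter the equation of index [k]
    with a negative sign. *)
Lemma triangular_lower_bound k : (t < k <= m)%N ->
  b * a k / gamma k k * (1 - A k - \sum_(t.+1 <= j < k) B k j * (1 - A j / l))
    <= q k.
Proof.
move=> /[dup] tkm /andP[tk km]; rewrite -(ler_pM2l (gamma_gt0 km)).
have upper j : (t < j < k)%N ->
    q j <= (l * b * a j - gamma j 0%N * q 0%N) / gamma j j.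
  move=> /andP[tj jk]; have jm : (j <= m)%N by rewrite (leq_trans (ltnW jk)).
  have tjm : (t < j <= m)%N by rewrite tj.
  rewrite ler_pdivlMr ?gamma_gt0 // mulrC lerBrDl.
  have /andP[_] := w_bounds tjm; apply: le_trans; rewrite (w_expand tjm).
  rewrite addrAC lerDl big_nat; apply: sumr_ge0 => i /andP[_ ij].
  by rewrite mulr_ge0 ?gamma_ge0 // (leq_trans (ltnW ij)).
have -> : gamma k k * q k =
    w k - gamma k 0%N * q 0%N - \sum_(t.+1 <= j < k) gamma k j * q j.
  by rewrite (w_expand tkm) -addrA -opprD [X in X - _]addrC addrK.
have -> : gamma k k * (b * a k / gamma k k *
      (1 - A k - \sum_(t.+1 <= j < k) B k j * (1 - A j / l))) =
    b * a k - gamma k 0%N * q 0%N - \sum_(t.+1 <= j < k)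
      gamma k j * ((l * b * a j - gamma j 0%N * q 0%N) / gamma j j).
  have nzg := lt0r_neq0 (gamma_gt0 km); have nza := a_neq0 km.
  rewrite mulrA [_ * (_ / _)]mulrC divfK // !mulrBr mulr1; congr (_ - _ - _).
    by rewrite /A q0E; field; rewrite N_neq0 nza.
  rewrite mulr_sumr; apply: eq_big_nat => j /andP[tj jk].
  have jm : (j <= m)%N by rewrite (leq_trans (ltnW jk)).
  have nzj := lt0r_neq0 (gamma_gt0 jm); have nzaj := a_neq0 jm.
  by rewrite /A /B q0E; field; rewrite nzj nza nzaj N_neq0 l_neq0.
apply: lerB; first by apply: lerB => //; case/andP: (w_bounds tkm).
apply: ler_sum_nat => j tjk; have /andP[_ jk] := tjk.
by rewrite ler_wpM2l ?upper // gamma_ge0 // (leq_trans (ltnW jk)).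
Qed.

End TriangularBound.

(** * Projections of a design *)

Theorem theorem3p7 (R : realType) (d : Order.disp_t) (Omega : finPOrderType d)
    (rk : Omega -> nat) (m : nat)
    (gT : finGroupType) (G : {group gT}) (to : action G Omega)
    (adm : admissible rk m to)
    (t : nat) (ht : (t < m)%N)
    (D : {set Omega}) (lambda : nat) (hD : t_design rk m t D lambda)
    (hcomm : commutative_scheme to (fiber rk m))
    (U : nat -> 'M[R[i]]_#|fiber rk m|)
    (hU : irr_decomposition (perm_repr (adm_trans adm)) m U)
    (hU0 : (U 0%N :=: (const_mx 1 : 'rV[R[i]]_#|fiber rk m|))%MS) :
  let W k := incidence R[i] rk m k in
  let WW k := W k *m (W k)^T in
  let gamma k j := scalar_on (WW k) (U j) in
  let a k : R[i] := (alpha rk m k)%:R in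
  let b : R[i] := #|D|%:R in
  let N : R[i] := #|fiber rk m|%:R in
  let l : R[i] := lambda%:R in
  let A k := gamma k 0%N * b / (N * a k) in
  let B k j := l * a j * gamma k j / (a k * gamma j j) in
  let p k := charvec (fiber rk m) D *m proj_ortho (U k) in
  (forall k, (k <= m)%N -> ((W k)^T :=: \sum_(j < k.+1) U j)%MS)
  \/ (exists g : nat -> nat -> R[i],
        forall k j, (k <= m)%N -> (j <= m)%N ->
          [/\ 0 <= g k j, acts_as_scalar (WW k) (U j) (g k j),
              (j <= k)%N -> 0 < g k j & (k < j)%N -> g k j = 0]) ->
  (forall k, (t < k <= m)%N ->
     A k + \sum_(t.+1 <= j < k) B k j * (1 - l^-1 * A j) < 1) ->
  [/\ forall k, (1 <= k <= t)%N -> p k = 0,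
      forall k, (k == 0%N) || (t < k <= m)%N -> p k != 0,
      l2norm (p 0%N) ^+ 2 = b ^+ 2 / N
    & forall k, (t < k <= m)%N ->
        let bound := b * a k / gamma k k *
          (1 - A k - \sum_(t.+1 <= j < k) B k j * (1 - A j / l)) in
        bound <= l2norm (p k) ^+ 2 /\ 0 < bound].
Proof.
move=> W WW gamma a b N l A B p spec small.
have [orthU fullU] := (irrd_orth hU, irrd_full hU).
have gammaP : forall k j, (k <= m)%N -> (j <= m)%N ->
  [/\ 0 <= gamma k j, acts_as_scalar (WW k) (U j) (gamma k j),
      (j <= k)%N -> 0 < gamma k j & (k < j)%N -> gamma k j = 0].
  exact: incidence_spectrum hU spec.
have [/set0Pn[x0 x0D] DX _] := hD.
have x0X := subsetP DX _ x0D.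
have b_gt0 : 0 < b by rewrite ltr0n; apply/card_gt0P; exists x0.
have N_gt0 : 0 < N by rewrite ltr0n; apply/card_gt0P; exists x0.
have l_gt0 : 0 < l by rewrite ltr0n (design_index_gt0 adm ht hD).
have a_gt0 k : (k <= m)%N -> 0 < a k.
  by move=> km; rewrite ltr0n (alpha_gt0 adm km x0X).
have q0E : l2norm (p 0%N) ^+ 2 = b ^+ 2 / N.
  by rewrite l2norm_sqr dot_proj_const.
have p_eq0 k : (1 <= k <= t)%N -> p k = 0.
  case/andP=> k_gt0 kt; have tm := ltnW ht; have km := leq_trans kt tm.
  have scal i (im : (i <= m)%N) : acts_as_scalar (WW t) (U i) (gamma t i).
    by case: (gammaP t i tm im).
  have := proj_scalar_on orthU fullU (charvec (fiber rk m) D) scal km.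
  rewrite (design_gram adm DX ht hD) proj_ortho_0; last first.
    apply: scalemx_sub; rewrite -hU0; apply/orthomx_dotP; apply: orthU => // e.
    by rewrite -e in k_gt0.
  have [_ _ /(_ kt) g_gt0 _] := gammaP t k tm km.
  by move/esym/eqP; rewrite scaler_eq0 (negPf (lt0r_neq0 g_gt0)) => /eqP.
have q_ge0 k : 0 <= l2norm (p k) ^+ 2 by rewrite l2norm_sqr dnorm_ge0.
pose f : 'rV[R[i]]_#|fiber rk m| := charvec (fiber rk m) D.
pose w k := '[f *m W k].
have w_expand k : (t < k <= m)%N -> w k = gamma k 0%N * l2norm (p 0%N) ^+ 2
    + \sum_(t.+1 <= j < k) gamma k j * l2norm (p j) ^+ 2
    + gamma k k * l2norm (p k) ^+ 2.
  case/andP=> tk km; rewrite /w -dot_gram ?incidence_real //.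
  rewrite (dot_scalar_on orthU fullU (g := gamma k)); last first.
    by move=> i im; case: (gammaP k i km im).
  under eq_bigr => i _ do rewrite -l2norm_sqr.
  apply: (sum_outside_gaps (F := fun i => gamma k i * l2norm (p i) ^+ 2)).
  - by rewrite tk.
  - by move=> j jt; rewrite p_eq0 // l2norm_sqr linear0l mulr0.
  - move=> j /andP[kj jm]; have [_ _ _ ->] := gammaP k j km jm; last by [].
    by rewrite mul0r.
have bound_le k : (t < k <= m)%N ->
    b * a k / gamma k k *
      (1 - A k - \sum_(t.+1 <= j < k) B k j * (1 - A j / l)) <=
    l2norm (p k) ^+ 2.
  apply: (triangular_lower_bound (m := m) (gamma := gamma) (a := a) (w := w)
    (q := fun k => l2norm (p k) ^+ 2) (b := b) (N := N) (l := l)) => //.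
  - exact: lt0r_neq0.
  - exact: lt0r_neq0.
  - by move=> j jm; rewrite lt0r_neq0 ?a_gt0.
  - by move=> i j im jm; case: (gammaP i j im jm).
  - by move=> j jm; case: (gammaP j j jm jm) => _ _ ->.
  - move=> j /andP[tj jm]; apply: (dot_incidence_bounds adm DX hD).
    by rewrite ltnW.
have bound_gt0 k : (t < k <= m)%N ->
    0 < b * a k / gamma k k *
      (1 - A k - \sum_(t.+1 <= j < k) B k j * (1 - A j / l)).
  move=> /[dup] tkm /andP[_ km]; have [_ _ g_gt0 _] := gammaP k k km km.
  rewrite mulr_gt0 ?divr_gt0 ?mulr_gt0 ?a_gt0 ?g_gt0 //.
  rewrite -addrA -opprD subr_gt0; under eq_bigr do rewrite [_ / l]mulrC.
  exact: small.
split=> // [k|k tkm]; last by split; [exact: bound_le | exact: bound_gt0].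
have nz j : 0 < l2norm (p j) ^+ 2 -> p j != 0 by rewrite l2norm_sqr dnorm_gt0.
case/orP=> [/eqP->|tkm]; apply: nz.
  by rewrite q0E divr_gt0 ?exprn_gt0.
exact: Order.POrderTheory.lt_le_trans (bound_gt0 k tkm) (bound_le k tkm).
Qed.
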